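(* A strategy of the chair is outcome-equivalent to the insertion-sort strategy if and only if it is lexicographic.
   Context: Let $\mathcal{X}=\{1,\dots,n\}$ be a finite set of alternatives, labelled so that the chair's preference (a ranking) is $1\succ 2\succ\cdots\succ n$. A proto-ranking is an irreflexive transitive relation on $\mathcal{X}$; a ranking is a total proto-ranking; a tournament is a total asymmetric relation on $\mathcal{X}$. Interaction: given a tournament $\mathrel{W}$, set $R_0=\varnothing$; in each period $t\geq1$ with $R_{t-1}$ not total, the chair offers a pair $\{x,y\}$ unranked by $R_{t-1}$, the winner is $x$ if $x\mathrel{W}y$ and $y$ otherwise, and $R_t$ is the transitive closure of $R_{t-1}\cup\{(\text{winner},\text{loser})\}$; stop when $R_t$ is total. A history is a sequence of (winner, loser) pairs that can arise this way; a strategy assigns to each non-terminal history a pair unranked at it. The outcome $R^\sigma(\mathrel{W})$ of $\sigma$ under $\mathrel{W}$ is the final ranking. Two strategies are outcome-equivalent if they have the same outcome under every tournament. The insertion-sort strategy: at a history with current proto-ranking $R$, let $L(z)=\{w: z\succ w,\ \text{neither } zRw \text{ nor } wRz\}$; let $x$ be the $\succ$-worst alternative with $L(x)\ne\varnothing$, and $y$ the $R$-highest element of $L(x)$; offer $\{x,y\}$. Let $\mathcal{W}$ be the set of all tournaments on $\mathcal{X}$. For a strategy $\sigma$, alternative $x$ and $\mathrel{W}\in\mathcal{W}$, let $N^\sigma_x(\mathrel{W})=|\{y: x\succ y,\ x\, R^\sigma(\mathrel{W})\, y\}|$. Strategy $\sigma$ is better for $x$ than $\sigma'$ if for each $k\in\{1,\dots,n-1\}$,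 $|\{\mathrel{W}\in\mathcal{W}: N^\sigma_x(\mathrel{W})\ge k\}|\ge|\{\mathrel{W}\in\mathcal{W}: N^{\sigma'}_x(\mathrel{W})\ge k\}|$. Given a set $\Sigma$ of strategies, $\sigma\in\Sigma$ is best for $x$ among $\Sigma$ if it is better for $x$ than every $\sigma'\in\Sigma$. A strategy is lexicographic if, among all strategies, it is best for $1$; among such strategies, it is best for $2$; among such strategies, best for $3$; and so on (i.e. with $B_0$ the set of all strategies and $B_k$ the set of strategies in $B_{k-1}$ that are best for $k$ among $B_{k-1}$, the strategy lies in every $B_k$). *)

(* Defs.v *)
(* Alternatives X = {1,..,n} are modelled by 'I_n, with
   alternative k+1 represented by the ordinal k; the chair's ranking
   1 > 2 > ... > n becomes: x is chair-preferred to y  iff  x < y. *)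
From mathcomp Require Import all_boot.
Set Implicit Arguments.
Unset Strict Implicit.
Unset Printing Implicit Defensive.

Section Chair.
Variable n : nat.
Notation alt := 'I_n.

Definition chair_pref (x y : alt) : bool := x < y.

(* A history: sequence of (winner, loser) pairs. *)
Definition history := seq (alt * alt).

(* Transitive closure of the pairs recorded in a history: the current
   proto-ranking R. *)
Definition tc (h : history) : rel alt :=
  fun x y => [exists z, ((x, z) \in h) && connect (fun a b => (a, b) \in h) z y].

Definition unranked (h : history) (x y : alt) : bool :=
  (x != y) && ~~ tc h x y && ~~ tc h y x.

Definition total_hist (h : history) : bool :=
  [forall x, forall y, (x != y) ==> (tc h x y || tc h y x)].

Fixpoint hist_aux (pre : history) (rest : history) : bool :=
  match rest with
  | [::] => true
  | p :: r => [&& ~~ total_hist pre, unranked pre p.1 p.2 & hist_aux (rcons pre p) r]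
  end.
Definition is_history (h : history) : bool := hist_aux [::] h.

Definition strategy := history -> option (alt * alt).

Definition valid_strategy (s : strategy) : Prop :=
  forall h, is_history h -> ~~ total_hist h ->
    match s h with Some (x, y) => unranked h x y | None => false end.

Definition tournament (W : {set alt * alt}) : bool :=
  [forall x, (x, x) \notin W] &&
  [forall x, forall y, (x != y) ==> (((x, y) \in W) != ((y, x) \in W))].

Definition winner_loser (W : {set alt * alt}) (x y : alt) : alt * alt :=
  if (x, y) \in W then (x, y) else (y, x).

(* Run the interaction; each step ranks at least one new pair, so n*n steps
   suffice for a valid strategy to reach a total ranking. *)
Fixpoint play (s : strategy) (W : {set alt * alt}) (fuel : nat) (h : history)
  : history :=
  match fuel with
  | 0 => h
  | k.+1 =>
      if total_hist h then h else
      match s h with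
      | Some (x, y) => play s W k (rcons h (winner_loser W x y))
      | None => h
      end
  end.

Definition outcome (s : strategy) (W : {set alt * alt}) : rel alt :=
  tc (play s W (n * n) [::]).

Definition outcome_equivalent (s s' : strategy) : Prop :=
  forall W, tournament W -> forall x y, outcome s W x y = outcome s' W x y.

Definition Lset (h : history) (z : alt) : {set alt} :=
  [set w | chair_pref z w & unranked h z w].

Definition insertion_sort : strategy := fun h =>
  match [pick x | (Lset h x != set0) &&
                  [forall z, chair_pref x z ==> (Lset h z == set0)]] with
  | Some x =>
      match [pick y | (y \in Lset h x) &&
                      [forall w, (w \in Lset h x) ==> ~~ tc h w y]] with
      | Some y => Some (x, y)
      | None => None
      end
  | None => None
  end.

Definition Nx (s : strategy) (x : alt) (W : {set alt * alt}) : nat :=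
  #|[set y | chair_pref x y & outcome s W x y]|.

Definition count_ge (s : strategy) (x : alt) (k : nat) : nat :=
  #|[set W : {set alt * alt} | tournament W & k <= Nx s x W]|.

Definition better_for (x : alt) (s s' : strategy) : Prop :=
  forall k, 1 <= k <= n.-1 -> count_ge s' x k <= count_ge s x k.

Definition best_among (S : strategy -> Prop) (x : alt) (s : strategy) : Prop :=
  S s /\ forall s', S s' -> better_for x s s'.

(* B_0 = all strategies; B_k = strategies of B_{k-1} best for alternative k
   (alternative k is the ordinal k-1). *)
Fixpoint Bset (k : nat) : strategy -> Prop :=
  match k with
  | 0 => valid_strategy
  | k'.+1 => fun s => forall Hk : k' < n, best_among (Bset k') (Ordinal Hk) s
  end.

Definition lexicographic (s : strategy) : Prop := forall k, k <= n -> Bset k s.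

End Chair.

(* Main.v *)
(** Say that a strategy is top-first at x if, whenever x is offered against a
    worse alternative, that alternative is ranked above every other worse
    alternative still unranked with x.  If this holds at every y better than x,
    contests involving such a y reveal nothing about the ranking of x and the
    alternatives below it, so x can only be placed under worse alternatives by
    losing to them.  Hence, if x loses its first j contests against worse
    alternatives (an event to which independent fair coins give probability
    2^-j), at least j of them end up above x.  Equality for all j means that
    exactly the alternatives to which x loses before its first win end up above
    x; this is in turn equivalent to being top-first at x, since otherwise an
    alternative left unranked by a win of x can still end up above x.  So a
    lexicographic strategy is one that is top-first everywhere.  Insertion sort
    is top-first everywhere, and being top-first everywhere determines the
    outcome: x beats y iff x wins under W against some z worse than x and
    ranked weakly above y. *)

Require Import Defs.
From mathcomp Require Import all_boot.
From mathcomp Require Import zify.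

Set Implicit Arguments.
Unset Strict Implicit.
Unset Printing Implicit Defensive.

(** * Chains in a history *)

Section Histories.
Variable n : nat.
Implicit Types (h : history n) (x y z a b c : 'I_n) (W : {set 'I_n * 'I_n}).

(** Reflexive, unlike [tc], so that chains concatenate without case distinctions. *)
Definition conn h := connect (fun a b => (a, b) \in h).

Lemma conn_tc h x y : conn h x y = (x == y) || tc h x y.
Proof.
apply/idP/idP.
  case/connectP=> -[|z p] /= ; first by move=> _ ->; rewrite eqxx.
  case/andP=> xz zp ->; apply/orP; right; apply/existsP; exists z.
  by rewrite xz; apply/connectP; exists p.
case/orP=> [/eqP-> |]; first exact: connect0.
by case/existsP=> z /andP[xz]; apply: connect_trans; apply: connect1.
Qed.

Lemma tc_conn h x y : x != y -> tc h x y = conn h x y.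
Proof. by rewrite conn_tc => /negPf->. Qed.

Lemma unrankedE h x y : unranked h x y = ~~ conn h x y && ~~ conn h y x.
Proof.
by rewrite /unranked !conn_tc [y == x]eq_sym; case: (x == y); rewrite //= andbF.
Qed.

Lemma unranked_sym h x y : unranked h x y = unranked h y x.
Proof. by rewrite !unrankedE andbC. Qed.

Lemma edge_conn h x y : (x, y) \in h -> conn h x y.
Proof. exact: connect1. Qed.

Lemma conn_sub h h' x y : {subset h <= h'} -> conn h x y -> conn h' x y.
Proof.
move=> sub; apply: connect_sub => a b ab; apply: connect1; exact: sub.
Qed.

Lemma conn_first h x y : conn h x y -> x != y -> exists2 z, (x, z) \in h & conn h z y.
Proof.
rewrite conn_tc => /orP[-> //|/existsP[z /andP[xz zy]] _]; by exists z.
Qed.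

Lemma conn_last h x y : conn h x y -> x != y -> exists2 z, conn h x z & (z, y) \in h.
Proof.
case/connectP=> p; elim/last_ind: p => [|p z _]; first by move=> _ ->; rewrite eqxx.
rewrite rcons_path last_rcons => /andP[px lz] -> _.
by exists (last x p) => //; apply/connectP; exists p.
Qed.

Lemma sub_rcons h p : {subset h <= rcons h p}.
Proof. by move=> q qh; rewrite mem_rcons inE qh orbT. Qed.

(** A chain through the new pair is cut before its first and after its last use of that pair; both
    pieces lie in [h]. *)
Lemma conn_rcons h a b x y : conn (rcons h (a, b)) x y ->
  conn h x y \/ conn h x a /\ conn h b y.
Proof.
case/connectP=> p; elim: p x => [|z p IHp] x /=.
  by move=> _ ->; left; apply: connect0.
case/andP; rewrite mem_rcons inE => /orP[/eqP[-> ->]|xz] zp yE.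
  case: (IHp _ zp yE) => [zy|[zx zy]]; right; split=> //; exact: connect0.
case: (IHp _ zp yE) => [zy|[zx zy]]; [left | right; split=> //].
  by apply: connect_trans zy; apply: connect1.
by apply: connect_trans zx; apply: connect1.
Qed.

Lemma unranked_rcons h p x y : unranked (rcons h p) x y -> unranked h x y.
Proof.
rewrite !unrankedE => /andP[/negP xy /negP yx].
by apply/andP; split; apply/negP=> /(conn_sub (@sub_rcons h p)).
Qed.

(** * Chains confined to the alternatives from [k] on *)

Definition among (k : nat) h : history n :=
  [seq p : 'I_n * 'I_n <- h | (k <= p.1) && (k <= p.2)].

Lemma mem_among k h a b :
  ((a, b) \in among k h) = [&& k <= a, k <= b & (a, b) \in h].
Proof. by rewrite mem_filter /= andbA. Qed.

Lemma among_sub k h : {subset among k h <= h}.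
Proof. by move=> p; rewrite mem_filter => /andP[]. Qed.

Lemma among_mono k h h' :
  {subset h <= h'} -> {subset among k h <= among k h'}.
Proof. by move=> sub p; rewrite !mem_filter => /andP[-> /sub]. Qed.

Lemma among0 h : among 0 h = h.
Proof. by rewrite /among (eq_filter (a2 := predT)) ?filter_predT. Qed.

(** Each passage [a], [x], [b] of a chain is replaced by a chain that avoids [x]. Such a passage
    uses up two pairs at once, hence the strong induction on length. *)
Lemma among_bypass x h :
    (x, x) \notin h ->
    (forall a b, x < a -> x < b -> (a, x) \in h -> (x, b) \in h ->
       conn (among x.+1 h) a b) ->
  forall a b, x < a -> x < b -> conn (among x h) a b -> conn (among x.+1 h) a b.
Proof.
move=> irr byp a b xa xb /connectP[p]; have [m] := ubnP (size p).
elim: m p a xa => // m IHm [|a1 p] a xa /=; first by move=> _ _ ->; apply: connect0.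
rewrite ltnS mem_among => szp /andP[/and3P[_ xa1 aa1] pP] bE.
have [xa1'|a1x] := ltnP x a1.
  apply: connect_trans (IHm p a1 xa1' szp pP bE); apply: connect1.
  by rewrite mem_among xa xa1' aa1.
have {xa1 a1x} a1E : a1 = x by apply/val_inj/eqP; rewrite eqn_leq a1x xa1.
subst a1; case: p szp pP bE => [|b1 p] /= szp; first by move=> _ bE; rewrite bE ltnn in xb.
rewrite mem_among => /andP[/and3P[_ xb1 xb1h] pP] bE.
have xb1' : x < b1.
  by rewrite ltn_neqAle xb1 andbT; apply: contra irr => /eqP/val_inj xE;
    rewrite -xE in xb1h; rewrite xb1h.
apply: connect_trans (byp _ _ xa xb1' aa1 xb1h) _.
exact: (IHm p b1 xb1' (ltnW szp) pP bE).
Qed.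

(** * Acyclicity of histories *)

Lemma hist_aux_rcons (pre h : history n) p :
  hist_aux pre (rcons h p) =
  [&& hist_aux pre h, ~~ total_hist (pre ++ h) & unranked (pre ++ h) p.1 p.2].
Proof.
elim: h pre => [|q h IHh] pre /=; first by rewrite cats0 andbT.
by rewrite IHh cat_rcons -!andbA.
Qed.

Lemma history_rcons h p : is_history (rcons h p) =
  [&& is_history h, ~~ total_hist h & unranked h p.1 p.2].
Proof. exact: hist_aux_rcons. Qed.

(** A cycle through the new pair would contain a chain from its loser to its winner, but the two
    were unranked. *)
Lemma history_antisym h x y : is_history h -> conn h x y -> conn h y x -> x = y.
Proof.
elim/last_ind: h x y => [|h [a b] IHh] x y.
  move=> _ xy _; apply/eqP; apply: contraTT isT => nxy.
  by case: (conn_first xy nxy).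
rewrite history_rcons unrankedE => /and3P[hh _ /andP[/negP nab /negP nba]].
move=> /conn_rcons[xy|[xa By]] /conn_rcons[yx|[ya bx]].
- exact: IHh.
- by case: nba; apply: connect_trans bx (connect_trans xy ya).
- by case: nba; apply: connect_trans By (connect_trans yx xa).
- by case: nba; apply: connect_trans By ya.
Qed.

Lemma history_irr h x : is_history h -> (x, x) \notin h.
Proof.
elim/last_ind: h => // h [a b] IHh; rewrite history_rcons mem_rcons inE negb_or.
move=> /and3P[hh _ /andP[/andP[nab _] _]]; rewrite IHh // andbT.
by apply: contra nab => /eqP[<- <-].
Qed.

Lemma history_tc_irr h x : is_history h -> tc h x x = false.
Proof.
move=> hh; apply: contraTF isT => txx; case/existsP: txx => z /andP[xz zx].
have := history_antisym hh (edge_conn xz) zx.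
by move=> zE; subst z; rewrite (negPf (history_irr x hh)) in xz.
Qed.

End Histories.

(** * Runs of a strategy *)

Section Play.
Variables (n : nat) (s : strategy n).
Implicit Types (h : history n) (x y z a b c : 'I_n) (W : {set 'I_n * 'I_n}).

(** Both results of an offer are allowed, so no tournament is involved. *)
Inductive reach : history n -> Prop :=
| reach_nil : reach [::]
| reach_rcons h a b : reach h -> ~~ total_hist h ->
    s h = Some (a, b) \/ s h = Some (b, a) -> reach (rcons h (a, b)).

Hypothesis sV : valid_strategy s.

Lemma offer_unranked h a b : is_history h -> ~~ total_hist h ->
  s h = Some (a, b) \/ s h = Some (b, a) -> unranked h a b.
Proof.
move=> hh ht; by have := sV hh ht => /[swap] -[->|->] //; rewrite unranked_sym.
Qed.

Lemma reach_history h : reach h -> is_history h.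
Proof.
elim=> // h' a b _ hh ht sh.
by rewrite /is_history hist_aux_rcons -/(is_history h') hh ht offer_unranked.
Qed.

Lemma reach_unranked h a b : reach h -> ~~ total_hist h ->
  s h = Some (a, b) \/ s h = Some (b, a) -> unranked h a b.
Proof. by move/reach_history; apply: offer_unranked. Qed.

Lemma reach_antisym h x y : reach h -> conn h x y -> conn h y x -> x = y.
Proof. by move/reach_history; apply: history_antisym. Qed.

Lemma reach_irr h x : reach h -> (x, x) \notin h.
Proof. by move/reach_history; apply: history_irr. Qed.

Lemma reach_uniq h : reach h -> uniq h.
Proof.
elim=> // h' a b rh IHh ht sh; rewrite rcons_uniq IHh andbT.
have := reach_unranked rh ht sh; rewrite unrankedE => /andP[+ _].
by apply: contra; apply: edge_conn.
Qed.

Lemma reach_edgeN h x y : reach h -> (x, y) \in h -> (y, x) \notin h.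
Proof.
move=> rh xy; apply/negP=> yx.
have xE := reach_antisym rh (edge_conn xy) (edge_conn yx).
by subst y; rewrite (negPf (reach_irr x rh)) in xy.
Qed.

Lemma totalP h x y : total_hist h -> conn h x y || conn h y x.
Proof.
move=> /forallP/(_ x)/forallP/(_ y)/implyP; rewrite !conn_tc [y == x]eq_sym.
by case: eqP => //= _; apply.
Qed.

Lemma offer h : reach h -> ~~ total_hist h -> exists a b, s h = Some (a, b).
Proof.
move=> rh ht; have := sV (reach_history rh) ht.
by case: (s h) => [[a b]|//] _; exists a, b.
Qed.

Definition consistent h W := all (fun p => p \in W) h.

Lemma tournament_sym W x y : tournament W -> x != y -> ((x, y) \in W) = ((y, x) \notin W).
Proof.
move=> /andP[_ /forallP/(_ x)/forallP/(_ y)/implyP/[apply]].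
by case: (_ \in W); case: (_ \in W).
Qed.

Lemma winner_loserE W x y : tournament W -> x != y -> (x, y) \in W ->
  winner_loser W x y = (x, y) /\ winner_loser W y x = (x, y).
Proof.
move=> tW nxy xy; rewrite /winner_loser xy.
by move: xy; rewrite (tournament_sym tW nxy) => /negPf->.
Qed.

Lemma winner_loser_in W x y : tournament W -> x != y -> winner_loser W x y \in W.
Proof.
move=> tW nxy; rewrite /winner_loser; case: ifP => // xyN.
by rewrite (tournament_sym tW) 1?eq_sym // xyN.
Qed.

Lemma play_reach W k h : tournament W -> reach h -> consistent h W ->
  reach (play s W k h) /\ consistent (play s W k h) W.
Proof.
move=> tW; elim: k h => //= k IHk h rh hW.
case: ifPn => // ht; case sh: (s h) => [[a b]|] //.
have /andP[/andP[nab _] _] := reach_unranked rh ht (or_introl sh).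
apply: IHk; last by rewrite /consistent all_rcons winner_loser_in.
by rewrite /winner_loser; case: ifP => _; constructor; auto.
Qed.

Lemma play_prefix W k h : exists t, play s W k h = h ++ t.
Proof.
elim: k h => [|k IHk] h /=; first by exists [::]; rewrite cats0.
case: ifP => _; first by exists [::]; rewrite cats0.
case: (s h) => [[a b]|]; last by exists [::]; rewrite cats0.
case: (IHk (rcons h (winner_loser W a b))) => t ->.
by rewrite cat_rcons; eexists.
Qed.

Lemma play_size W k h : tournament W -> reach h -> consistent h W ->
  total_hist (play s W k h) \/ size (play s W k h) = size h + k.
Proof.
move=> tW; elim: k h => [|k IHk] h rh hW /=; first by right; rewrite addn0.
case: ifPn => [|ht]; first by left.
case: (offer rh ht) => a [b sh].
have [] := play_reach 1 tW rh hW; rewrite /= (negPf ht) sh => rh1 h1W.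
by rewrite addnS -addSn -(size_rcons h (winner_loser W a b)); apply: IHk.
Qed.

Lemma reach_size h : reach h -> size h <= n * n.
Proof.
move/reach_uniq/card_uniqP=> <-.
by have := max_card (mem h); rewrite card_prod card_ord.
Qed.

Definition final W := play s W (n * n) [::].

Lemma final_reach W : tournament W -> reach (final W).
Proof. by move=> tW; case: (play_reach (n * n) tW reach_nil isT). Qed.

Lemma final_consistent W : tournament W -> consistent (final W) W.
Proof. by move=> tW; case: (play_reach (n * n) tW reach_nil isT). Qed.

(** If the fuel ran out, [n * n] distinct pairs would have been recorded, hence all pairs, and
    everything would be ranked. *)
Lemma final_total W : tournament W -> total_hist (final W).
Proof.
move=> tW; case: (play_size (n * n) tW reach_nil isT) => //; rewrite add0n => sz.
have /reach_uniq/card_uniqP := final_reach tW; rewrite sz => cE.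
apply/forallP=> x; apply/forallP=> y; apply/implyP=> nxy.
rewrite tc_conn //; suff -> : conn (final W) x y by [].
apply: edge_conn; suff /(_ (x, y)) -> : final W =i predT by [].
by apply/subset_cardP; rewrite ?subset_predT // cE card_prod card_ord.
Qed.

(** The tournament dictates every winner, so the run under [W] passes through [h] after [size h]
    steps. *)
Lemma final_prefix W h : tournament W -> reach h -> consistent h W ->
  exists t, final W = h ++ t.
Proof.
move=> tW rh hW; suff -> : final W = play s W (n * n - size h) h.
  exact: play_prefix.
have := reach_size rh; elim: rh hW => [|h' a b rh IHh ht sh]; first by rewrite subn0.
rewrite /consistent all_rcons => /andP[abW h'W]; rewrite size_rcons => szh.
rewrite IHh ?(ltnW szh) //; have -> : n * n - size h' = (n * n - (size h').+1).+1 by lia.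
rewrite /= (negPf ht); have /andP[/andP[nab _] _] := reach_unranked rh ht sh.
have [wab wba] := winner_loserE tW nab abW.
by case: sh => ->; rewrite ?wab ?wba.
Qed.

(** * Consequences of being top-first *)

Definition top_first x := forall h b, reach h -> ~~ total_hist h ->
  s h = Some (x, b) \/ s h = Some (b, x) -> x < b ->
  forall c, x < c -> unranked h x c -> c != b -> conn h b c.

(** The precise sense in which contests involving alternatives better than [k] reveal nothing about
    the others. *)
Definition closed_among (k : nat) := forall h a b, reach h ->
  k <= a -> k <= b -> conn h a b -> conn (among k h) a b.

(** Whatever was still unranked with [x] when it met [b] was below [b], so the win puts it below
    [x]. *)
Lemma ranked_after_win x h b c : top_first x -> reach h ->
  (x, b) \in h -> x < b -> x < c -> ~~ unranked h x c.
Proof.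
move=> tx rh; elim: rh => // h' u v rh IHh ht sh + xb xc.
rewrite mem_rcons inE => /orP[/eqP[uE vE]|xbh]; last first.
  by apply: contra (IHh xbh xb xc); apply: unranked_rcons.
subst u v; apply/negP => uxc.
have cb : c != b.
  apply: contraTneq uxc => cE; rewrite cE unrankedE edge_conn //.
  by rewrite mem_rcons mem_head.
have bc := tx _ _ rh ht sh xb c xc (unranked_rcons uxc) cb.
move: uxc; rewrite unrankedE => /andP[/negP[]].
apply: connect_trans (conn_sub (@sub_rcons _ h' (x, b)) bc).
by apply: edge_conn; rewrite mem_rcons mem_head.
Qed.

(** As [c] is unranked now, it was unranked when [x] met [a], hence below [a]. The chain from [a] to
    [c] can avoid [x]: leaving [x] would take an earlier win of [x], after which [c] would be
    ranked. *)
Lemma lost_to_top x h a c : top_first x -> closed_among x -> reach h ->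
  (a, x) \in h -> x < a -> x < c -> unranked h x c -> conn (among x.+1 h) a c.
Proof.
move=> tx cx rh; elim: rh => // h' u v rh IHh ht sh + xa xc uxc.
have uxc' := unranked_rcons uxc.
rewrite mem_rcons inE => /orP[/eqP[uE vE]|axh]; last first.
  exact: conn_sub (among_mono (@sub_rcons _ _ _)) (IHh axh xa xc uxc').
subst u v; have ca : c != a.
  apply: contraTneq uxc => cE; rewrite cE unrankedE andbC edge_conn //.
  by rewrite mem_rcons mem_head.
have ac : conn h' a c by apply: (tx _ _ rh ht _ xa c xc uxc' ca); case: sh; auto.
apply: conn_sub (among_mono (@sub_rcons _ h' (a, x))) _.
apply: (among_bypass (reach_irr x rh) _ xa xc (cx _ _ _ rh (ltnW xa) (ltnW xc) ac)).
move=> a1 b1 _ xb1 _ xb1h.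
by case/negP: (ranked_after_win tx rh xb1h xb1 xc).
Qed.

(** The loss to [a] precedes the win over [b], since nothing worse is left unranked after a win. So
    [b] was unranked with [x] after the loss, and [lost_to_top] applies. *)
Lemma bypass x h a b : top_first x -> closed_among x -> reach h ->
  x < a -> x < b -> (a, x) \in h -> (x, b) \in h -> conn (among x.+1 h) a b.
Proof.
move=> tx cx rh xa xb; elim: rh => // h' u v rh IHh ht sh.
rewrite !mem_rcons !inE => /orP[/eqP[uE vE]|axh] /orP[/eqP[uE' vE']|xbh].
- by move: xa; rewrite uE uE' ltnn.
- have := ranked_after_win tx rh xbh xb xa.
  by rewrite uE vE unranked_sym (reach_unranked rh ht sh).
- subst u v; have uxb := reach_unranked rh ht sh.
  exact: conn_sub (among_mono (@sub_rcons _ _ _)) (lost_to_top tx cx rh axh xa xb uxb).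
- exact: conn_sub (among_mono (@sub_rcons _ _ _)) (IHh axh xbh).
Qed.

Lemma closed_amongS x : top_first x -> closed_among x -> closed_among x.+1.
Proof.
move=> tx cx h a b rh xa xb ab.
apply: (among_bypass (reach_irr x rh) _ xa xb (cx _ _ _ rh (ltnW xa) (ltnW xb) ab)).
by move=> ? ? ? ?; apply: bypass.
Qed.

Lemma top_first_closed (k : nat) :
  (forall y, y < k -> top_first y) -> k <= n -> closed_among k.
Proof.
elim: k => [|k IHk] tk kn; first by move=> h a b _ _ _; rewrite among0.
apply: (@closed_amongS (Ordinal kn)); first exact: tk.
by apply: IHk (ltnW kn) => y yk; apply/tk/ltnW.
Qed.

(** Take the last alternative [z'] before [x] on a chain from [z]. If [z] was unranked with [x]
    before the latest contest, being top-first puts [z'] above [z], which forces [z = z']; otherwise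
    induction applies. *)
Lemma direct_loss x h z : top_first x -> closed_among x -> reach h ->
  x < z -> conn h z x -> (z, x) \in h.
Proof.
move=> tx cx rh; elim: rh z => [|h' u v rh IHh ht sh] z xz zx.
  by have [|y] := conn_first zx; rewrite // neq_ltn xz orbT.
have rh' : reach (rcons h' (u, v)) by constructor.
have nzx : z != x by rewrite neq_ltn xz orbT.
have [z' ] := conn_last (cx _ _ _ rh' (ltnW xz) (leqnn x) zx) nzx.
move=> /(conn_sub (@among_sub _ _ _)) zz'; rewrite mem_among => /and3P[xz' _ z'x].
have {}xz' : x < z'.
  rewrite ltn_neqAle xz' andbT; apply: contraTneq z'x => /val_inj <-.
  exact: reach_irr rh'.
have [zE|nz'] := eqVneq z z'; first by rewrite zE.
have : conn h' x z \/ (z, x) \in h' \/ conn h' z' z.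
  have [uxz|] := boolP (unranked h' x z); last first.
    by rewrite unrankedE negb_and !negbK => /orP[]; auto.
  right; right.
  move: z'x; rewrite mem_rcons inE => /orP[/eqP[uE vE]|z'x].
    subst u v; apply: (tx _ _ rh ht _ xz' z xz uxz nz'); case: sh; auto.
  exact: conn_sub (@among_sub _ _ _) (lost_to_top tx cx rh z'x xz' xz uxz).
case=> [xz''|[zxh'|z'z]].
- case/eqP: nzx; exact: reach_antisym rh' zx (conn_sub (@sub_rcons _ _ _) xz'').
- by rewrite mem_rcons inE zxh' orbT.
- case/eqP: nz'; exact: reach_antisym rh' zz' (conn_sub (@sub_rcons _ _ _) z'z).
Qed.

(** * Initial losses and their potential *)

Definition contests x h : history n := [seq p : 'I_n * 'I_n <- h |
  (p.1 == x) && (x < p.2) || (p.2 == x) && (x < p.1)].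
Definition won x h := has (fun p => p.1 == x) (contests x h).
(** Without a win, [find] returns the length, so an unbroken run of losses counts in full. *)
Definition initial_losses x h := find (fun p => p.1 == x) (contests x h).
Definition losses x h := [set z : 'I_n | (x < z) && ((z, x) \in h)].

Lemma won_mem x z h : x < z -> (x, z) \in h -> won x h.
Proof.
move=> xz xzh; apply/hasP; exists (x, z) => //=.
by rewrite mem_filter /= eqxx xz xzh.
Qed.

Lemma wonP x h : won x h -> exists2 z : 'I_n, x < z & (x, z) \in h.
Proof.
case/hasP=> -[a z]; rewrite mem_filter /= => /andP[+ azh] /eqP aE.
subst a; rewrite eqxx /= ltnn andbF orbF => xz; by exists z.
Qed.

Lemma initial_losses_cat x h t : won x h ->
  initial_losses x (h ++ t) = initial_losses x h.
Proof. by move=> w; rewrite /initial_losses /contests filter_cat find_cat -/(won x h) w. Qed.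

Lemma contests_rcons x h p : contests x (rcons h p) =
  if (p.1 == x) && (x < p.2) || (p.2 == x) && (x < p.1)
  then rcons (contests x h) p else contests x h.
Proof. by rewrite /contests filter_rcons. Qed.

Lemma won_rcons x h a b : won x (rcons h (a, b)) = won x h || (a == x) && (x < b).
Proof.
rewrite /won contests_rcons /=; have [->|] := eqVneq a x; last first.
  by move=> ax /=; rewrite orbF; case: ifP => _ //; rewrite has_rcons /= (negPf ax).
rewrite ltnn andbF orbF /=; case: ifP => _; last by rewrite orbF.
by rewrite has_rcons /= eqxx orbT.
Qed.

Lemma initial_losses_rcons x h a b : initial_losses x (rcons h (a, b)) =
  initial_losses x h + [&& b == x, x < a & ~~ won x h].
Proof.
rewrite /initial_losses contests_rcons /=; have [->|ax] := eqVneq a x.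
  rewrite ltnn !andbF addn0 /=; case: ifP => // _.
  rewrite -cats1 find_cat; case: ifP => // hN.
  by rewrite /= eqxx addn0 hasNfind ?hN.
case: ifP => /= [/andP[-> ->]|]; last first.
  by rewrite andbA => ->; rewrite addn0.
rewrite -cats1 find_cat -/(won x h); case: ifP => wN; first by rewrite addn0.
by rewrite /= (negPf ax) hasNfind ?addn1 //; apply: negbT.
Qed.

Lemma losses_rcons x h a b : reach (rcons h (a, b)) ->
  #|losses x (rcons h (a, b))| = #|losses x h| + ((b == x) && (x < a)).
Proof.
move/reach_uniq; rewrite rcons_uniq => /andP[abh _].
have [/andP[/eqP bE xa]|bx] := boolP ((b == x) && (x < a)).
  subst b; rewrite addn1 -add1n.
  have -> : losses x (rcons h (a, x)) = a |: losses x h.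
    apply/setP=> z; rewrite !inE mem_rcons inE xpair_eqE eqxx andbT andb_orr.
    by have [->|] := eqVneq z a; rewrite ?xa ?andbF.
  by rewrite cardsU1 inE negb_and abh orbT.
rewrite addn0; congr #|pred_of_set _|; apply/setP=> z.
rewrite !inE mem_rcons inE xpair_eqE; apply: andb_id2l => xz.
case: andP => // -[/eqP zE /eqP xE]; subst z x.
by rewrite eqxx xz in bx.
Qed.

Lemma initial_losses_le x h : reach h -> initial_losses x h <= #|losses x h|.
Proof.
elim=> // h' a b rh IHh ht sh; rewrite initial_losses_rcons losses_rcons; last by constructor.
by apply: leq_add IHh _; case: (b == x) => //=; case: (x < a) => //=; case: (won _ _).
Qed.

(** By [ranked_after_win], the first win of [x] ends its contests against worse alternatives, so
    every loss is initial. *)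
Lemma initial_lossesE x h : top_first x -> reach h -> initial_losses x h = #|losses x h|.
Proof.
move=> tx; elim=> [|h' a b rh IHh ht sh].
  by apply/esym/eqP; rewrite cards_eq0; apply/eqP/setP=> z; rewrite !inE andbF.
rewrite initial_losses_rcons losses_rcons ?IHh; last by constructor.
congr (_ + _); have [bE|] //= := eqVneq b x; have [xa|] //= := ltnP x a.
subst b; case wx: (won x h') => //=; have [z xz xzh] := wonP wx.
have := ranked_after_win tx rh xzh xz xa.
by rewrite unranked_sym (reach_unranked rh ht sh).
Qed.

(** [2 ^ j] times the conditional probability, given [h] and fair coins, that
    [x] loses its first [j] contests against worse alternatives, where the
    contests are imagined to go on after the end of the interaction. *)
Definition potential (j : nat) x h :=
  if j <= initial_losses x h then 2 ^ j else
  if won x h then 0 else 2 ^ initial_losses x h.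

Lemma potential_nil (j : nat) x : 0 < j -> potential j x [::] = 1.
Proof. by case: j. Qed.

(** The martingale property. Only a contest of [x] against a worse alternative, before its first win
    and its [j]-th loss, changes the potential: a loss doubles it and a win sends it to 0. *)
Lemma potential_step (j : nat) x h a b : a != b ->
  potential j x (rcons h (a, b)) + potential j x (rcons h (b, a)) = 2 * potential j x h.
Proof.
(* Swapping [a] and [b] leaves two cases: [x] is [b], or [x] takes no part. *)
wlog: a b / (b == x) || (a != x).
  move=> wl nab; have [bx|bx] := boolP ((b == x) || (a != x)); first exact: wl.
  rewrite addnC; apply: wl; last by rewrite eq_sym.
  by move: bx; rewrite negb_or negbK => /andP[_ ->].
move=> /orP bax nab; rewrite /potential !won_rcons !initial_losses_rcons.
have [xb|xb] := eqVneq b x.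
  rewrite -xb (negPf nab) /= orbF addn0.
  have [ba|ba] /= := ltnP b a; last by rewrite addn0 orbF; lia.
  rewrite orbT; case: (won b h) => /=; first by rewrite addn0; case: ifP => _; lia.
  rewrite addn1; move: (initial_losses b h) => l.
  have [jl|lj] := leqP j l; first by rewrite (leqW jl); lia.
  have [jl|jl] := leqP j l.+1; last by rewrite expnS; lia.
  have -> : j = l.+1 by lia.
  by rewrite expnS; lia.
case: bax => [bx|ax]; first by rewrite bx in xb.
by rewrite (negPf ax) /= orbF addn0; lia.
Qed.

Lemma tournamentI W : (forall x, (x, x) \notin W) ->
  (forall x y, x != y -> ((x, y) \in W) = ((y, x) \notin W)) -> tournament W.
Proof.
move=> irr asym; apply/andP; split; first exact/forallP.
apply/forallP=> x; apply/forallP=> y; apply/implyP=> /asym->.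
by case: (_ \in W).
Qed.

(** * Uniform tournaments as fair coins *)

Definition branch h := [set W | tournament W && consistent h W].

Lemma branch_rcons h a b W :
  (W \in branch (rcons h (a, b))) = (W \in branch h) && ((a, b) \in W).
Proof. by rewrite !inE /consistent all_rcons -andbA [_ && ((a, b) \in W)]andbC. Qed.

(** Reversing the single contest between [a] and [b] is injective and keeps consistency with [h],
    which does not contain that contest. *)
Lemma branch_le h a b : unranked h a b ->
  #|branch (rcons h (a, b))| <= #|branch (rcons h (b, a))|.
Proof.
move=> uab; have /andP[/andP[nab _] _] := uab.
have nba : (b, a) != (a, b) by rewrite xpair_eqE negb_and eq_sym nab.
pose flip W : {set 'I_n * 'I_n} := (b, a) |: (W :\ (a, b)).
have flip_inj : {in branch (rcons h (a, b)) &, injective flip}.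
  apply: (can_in_inj (g := fun W => (a, b) |: (W :\ (b, a)))) => W.
  rewrite branch_rcons inE => /andP[/andP[tW _] abW].
  have baW : (b, a) \notin W by rewrite -(tournament_sym tW).
  rewrite /flip setU1K ?setD1K //.
  by rewrite !inE negb_and baW orbT.
rewrite -(card_in_imset flip_inj); apply/subset_leq_card/subsetP=> _ /imsetP[W + ->].
rewrite !branch_rcons !inE eqxx andbT => /andP[/andP[tW /allP hW] abW].
have /[!unrankedE] /andP[/negP abN /negP baN] := uab.
apply/andP; split; last first.
  apply/allP=> p ph; rewrite !inE hW // andbT; apply/orP; right.
  by apply/eqP=> pE; apply: abN; apply: edge_conn; rewrite -pE.
have WN := tournament_sym tW.
apply: tournamentI => [x|x y nxy].
  have /andP[/forallP/(_ x) xxW _] := tW.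
  rewrite !inE (negPf xxW) andbF orbF; apply: contra nab.
  by rewrite xpair_eqE => /andP[/eqP<- /eqP<-].
rewrite !inE !xpair_eqE (WN _ _ nxy).
have [xb|xb] := eqVneq x b; have [ya|ya] := eqVneq y a; rewrite /= ?andbF /=;
  try by rewrite negb_or [(y == b) && _]andbC.
by subst x y; rewrite (negPf nab).
Qed.

Lemma branch_eq h a b : unranked h a b ->
  #|branch (rcons h (a, b))| = #|branch (rcons h (b, a))|.
Proof.
move=> uab; apply/eqP; rewrite eqn_leq branch_le //=.
by apply: branch_le; rewrite unranked_sym.
Qed.

(** Martingales keep their mean along a run: each offer splits the branch into two halves of equal
    size. *)
Lemma play_sum (f : history n -> nat) k h :
    (forall h a b, a != b -> f (rcons h (a, b)) + f (rcons h (b, a)) = 2 * f h) ->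
  reach h -> \sum_(W in branch h) f (play s W k h) = #|branch h| * f h.
Proof.
move=> fstep; elim: k h => [|k IHk] h rh /=; first by rewrite sum_nat_const.
have [ht|ht] := boolP (total_hist h); first by rewrite sum_nat_const.
have [a [b sh]] := offer rh ht; rewrite sh.
have uab := reach_unranked rh ht (or_introl sh).
have /andP[/andP[nab _] _] := uab.
have branch_loss W : (W \in branch h) && ((a, b) \notin W) = (W \in branch (rcons h (b, a))).
  rewrite branch_rcons; case: (boolP (W \in branch h)) => //=; rewrite inE => /andP[tW _].
  by rewrite (tournament_sym tW) ?negbK // eq_sym.
rewrite (bigID (fun W => (a, b) \in W)) /=.
rewrite (eq_bigl (fun W => W \in branch (rcons h (a, b)))) => [|W]; last by rewrite branch_rcons.
rewrite [X in _ + X](eq_bigl (fun W => W \in branch (rcons h (b, a)))) //.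
rewrite (eq_bigr (fun W => f (play s W k (rcons h (a, b))))) => [|W]; last first.
  by rewrite branch_rcons => /andP[_ abW]; rewrite /winner_loser abW.
rewrite [X in _ + X](eq_bigr (fun W => f (play s W k (rcons h (b, a))))) => [|W]; last first.
  by rewrite -branch_loss => /andP[_ abW]; rewrite /winner_loser (negPf abW).
rewrite !IHk; try by constructor; auto.
have -> : #|branch h| = #|branch (rcons h (a, b))| + #|branch (rcons h (b, a))|.
  rewrite -(cardsID [set W : {set 'I_n * 'I_n} | (a, b) \in W]).
  congr (_ + _); apply: eq_card => W; first by rewrite branch_rcons !inE.
  by rewrite -branch_loss !inE andbC.
by rewrite -(branch_eq uab) -mulnDr fstep // addnn -muln2 mulnA.
Qed.

Lemma conn_upset (U : pred 'I_n) h x y :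
  (forall a b, (a, b) \in h -> U b -> U a) -> conn h x y -> U y -> U x.
Proof.
move=> Uh /connectP[p]; elim: p x => [|z p IHp] x /=; first by move=> _ ->.
by case/andP=> xz zp yE Uy; apply: Uh xz (IHp _ zp yE Uy).
Qed.

Lemma extend_above h c x : reach h -> unranked h c x ->
  exists W, [/\ tournament W, consistent h W & conn (final W) c x].
Proof.
move=> rh; rewrite unrankedE => /andP[_ xcN].
(* Outside of [h], let the up-set of [c] win against its complement; then no
   winning chain can lead from [x] to [c]. *)
pose U u := conn h u c.
pose wins a b := if U a == U b then a < b else U a.
pose W := [set p : 'I_n * 'I_n | (p \in h) || ((p.2, p.1) \notin h) && wins p.1 p.2].
have tW : tournament W.
  apply: tournamentI => [y|y z nyz]; rewrite !inE /=.
    by rewrite (negPf (reach_irr y rh)) /wins eqxx ltnn.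
  have winsN : wins y z = ~~ wins z y.
    rewrite /wins [U z == _]eq_sym; case: eqP => [_|]; last by case: (U y); case: (U z).
    by rewrite -leqNgt ltn_neqAle nyz.
  case yzh: ((y, z) \in h); first by rewrite (negPf (reach_edgeN rh yzh)).
  by case: ((z, y) \in h) => //=.
have hW : consistent h W by apply/allP=> p ph; rewrite inE ph.
exists W; split=> //; have /orP[//|] := totalP c x (final_total tW).
move=> xc; case/negP: xcN; apply: (@conn_upset U _ _ _ _ xc (connect0 _ c)) => a b.
move/(allP (final_consistent tW)); rewrite inE /= => /orP[/edge_conn|/andP[_]].
  by apply: connect_trans.
by rewrite /wins /U => + bc; rewrite bc; case: (conn h a c).
Qed.

(** * Calibration *)

Definition beaten x W := [set z : 'I_n | (x < z) && conn (final W) z x].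

(** The equality case of [initial_losses_beaten]. *)
Definition calibrated x :=
  forall W, tournament W -> #|beaten x W| = initial_losses x (final W).

Lemma losses_beaten x W : losses x (final W) \subset beaten x W.
Proof. by apply/subsetP=> z; rewrite !inE => /andP[-> /edge_conn]. Qed.

Lemma initial_losses_beaten x W : tournament W ->
  initial_losses x (final W) <= #|beaten x W|.
Proof.
move=> tW; apply: leq_trans (initial_losses_le x (final_reach tW)) _.
exact: subset_leq_card (losses_beaten x W).
Qed.

Lemma top_first_calibrated x : top_first x -> closed_among x -> calibrated x.
Proof.
move=> tx cx W tW; have rF := final_reach tW.
rewrite initial_lossesE //; apply/eq_card => z; rewrite !inE; apply: andb_id2l => xz.
by apply/idP/idP; [apply: direct_loss | apply: edge_conn].
Qed.

(** Suppose [c] is unranked with [x] and not below the offered [b]. A win of [x] over [b] fixes the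
    initial losses yet leaves [c] unranked, and some tournament then puts [c] above [x], one
    alternative too many. *)
Lemma calibrated_top_first x : calibrated x -> top_first x.
Proof.
move=> calx h b rh ht sh xb c xc uxc cb; apply: contraTT isT => bcN.
have rh1 : reach (rcons h (x, b)) by constructor.
have ucx1 : unranked (rcons h (x, b)) c x.
  move: uxc; rewrite !unrankedE => /andP[/negP xcN /negP cxN].
  apply/andP; split; apply/negP => /conn_rcons[//|[cx bx]].
    by apply: cxN.
  by case/negP: bcN.
have [W [tW hW cx]] := extend_above rh1 ucx1.
have [t FE] := final_prefix tW rh1 hW.
have wx : won x (rcons h (x, b)) by rewrite won_rcons eqxx xb orbT.
have := calx W tW; rewrite FE initial_losses_cat // => bE.
have := initial_losses_le x rh1; rewrite -bE leqNgt => /negP[].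
apply: proper_card; apply/properP; split.
  apply/subsetP=> z; rewrite !inE => /andP[-> zx].
  by apply: edge_conn; rewrite FE mem_cat zx.
exists c; rewrite !inE xc //=.
move: ucx1; rewrite unrankedE => /andP[+ _]; apply: contra; exact: edge_conn.
Qed.

(** * Tail bounds for the number of alternatives ending above [x] *)

Definition nbelow x := n - x.+1.

Lemma nbelowE x : #|[set z : 'I_n | x < z]| = nbelow x.
Proof.
rewrite -sum1dep_card -(big_mkord (fun i => x < i) (fun=> 1)).
rewrite (@big_cat_nat _ _ _ x.+1) //= big_nat_cond big_pred0 => [|i]; last by lia.
rewrite add0n big_nat_cond (eq_bigl (fun i => (x < i < n) && true)) => [|i]; last by lia.
by rewrite -big_nat_cond sum_nat_const_nat muln1.
Qed.

Lemma beaten_Nx x W : tournament W -> Nx s x W + #|beaten x W| = nbelow x.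
Proof.
move=> tW; rewrite -nbelowE -(cardsID [set y | outcome s W x y] [set z : 'I_n | x < z]).
congr (_ + _); apply: eq_card => z; rewrite !inE /outcome -/(final W) //.
have [xz|] := ltnP x z; rewrite ?andbF //= andbT tc_conn ?neq_ltn ?xz //.
have := totalP x z (final_total tW).
case xzF: (conn _ x z); case zxF: (conn _ z x) => //= _.
have zE := reach_antisym (final_reach tW) xzF zxF.
by rewrite zE ltnn in xz.
Qed.

(** A chain from [x] to a worse alternative could be taken among the alternatives from [x] on, and
    its first pair would be a win of [x]. *)
Lemma won_final x W : closed_among x -> tournament W ->
  ~~ won x (final W) -> #|beaten x W| = nbelow x.
Proof.
move=> cx tW wN; rewrite -nbelowE; apply: eq_card => z; rewrite !inE.
have [xz|//] /= := ltnP x z; have /orP[//|] := totalP z x (final_total tW).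
move=> xzF; have := cx _ _ _ (final_reach tW) (leqnn x) (ltnW xz) xzF.
have nxz : x != z by rewrite neq_ltn xz.
move=> /conn_first/(_ nxz)[y]; rewrite mem_among => /and3P[_ xy xyF] _.
case/negP: wN; apply: (won_mem _ xyF); rewrite ltn_neqAle xy andbT.
by apply: contraTneq xyF => /val_inj <-; apply: reach_irr (final_reach tW).
Qed.

Lemma potential_final (j : nat) x W : closed_among x -> tournament W ->
  j <= nbelow x -> potential j x (final W) <= 2 ^ j * (j <= #|beaten x W|).
Proof.
move=> cx tW jm; rewrite /potential; have lb := initial_losses_beaten x tW.
have [jl|lj] := leqP j (initial_losses x (final W)); first by rewrite (leq_trans jl lb) muln1.
case: ifPn => // wN; rewrite (won_final cx tW wN) jm muln1.
by rewrite leq_exp2l // ltnW.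
Qed.

Definition many_beaten (j : nat) x := [set W in branch [::] | j <= #|beaten x W|].

Lemma branch_nil W : (W \in branch [::]) = tournament W.
Proof. by rewrite inE andbT. Qed.

Lemma many_beatenE (j : nat) x :
  2 ^ j * #|many_beaten j x| = \sum_(W in branch [::]) 2 ^ j * (j <= #|beaten x W|).
Proof.
by rewrite -big_distrr /= /many_beaten -sum1dep_card big_mkcondr.
Qed.

Lemma potential_sum (j : nat) x : 0 < j ->
  \sum_(W in branch [::]) potential j x (final W) = #|branch [::]|.
Proof.
move=> j0; rewrite play_sum ?potential_nil ?muln1 //; last by constructor.
by move=> h a b; apply: potential_step.
Qed.

(** The potential has mean 1 and is bounded pointwise by [2 ^ j] times the indicator of the
    event. *)
Lemma many_beaten_ge (j : nat) x : closed_among x -> 0 < j <= nbelow x ->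
  #|branch [::]| <= 2 ^ j * #|many_beaten j x|.
Proof.
move=> cx /andP[j0 jm]; rewrite many_beatenE -(potential_sum x j0).
by apply: leq_sum => W; rewrite branch_nil => tW; apply: potential_final.
Qed.

(** Equality of the sums for every [j] forces the pointwise bound of [potential_final] to be an
    equality at every tournament. *)
Lemma calibratedP x : closed_among x ->
  calibrated x <->
  forall j : nat, 0 < j <= nbelow x -> 2 ^ j * #|many_beaten j x| <= #|branch [::]|.
Proof.
move=> cx; split=> [calx j /andP[j0 jm]|tight W tW].
  rewrite many_beatenE -(potential_sum x j0); apply: leq_sum => W; rewrite branch_nil => tW.
  rewrite (calx W tW) /potential.
  have [jl|lj] := leqP j (initial_losses x (final W)); first by rewrite muln1.
  by rewrite muln0.
apply/eqP; rewrite eqn_leq initial_losses_beaten // andbT leqNgt.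
apply/negP=> lb; set l := initial_losses x (final W) in lb.
have bm : #|beaten x W| <= nbelow x by rewrite -(beaten_Nx x tW) leq_addl.
(* At the threshold [l + 1] the tournament [W] makes the sum strict: its potential is at most
   [2 ^ l], its bound [2 ^ (l + 1)]. *)
have jm : 0 < l.+1 <= nbelow x by rewrite (leq_trans lb bm).
have := tight _ jm; rewrite many_beatenE -(potential_sum x (ltn0Sn l)) leqNgt => /negP[].
have WT : W \in branch [::] by rewrite branch_nil.
rewrite (bigD1 W) // [X in _ < X](bigD1 W) //= -addSn; apply: leq_add; last first.
  apply: leq_sum => W'; rewrite branch_nil => /andP[tW' _].
  by apply: potential_final => //; case/andP: jm.
rewrite lb muln1 /potential -/l ltnn; case: ifP => _; first by rewrite expn_gt0.
by rewrite ltn_exp2l.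
Qed.

End Play.

(** * Comparing strategies *)

Section Counting.
Variable n : nat.
Implicit Types (s : strategy n) (x : 'I_n).

Lemma count_geE s x (k : nat) : valid_strategy s -> k <= nbelow x ->
  count_ge s x k + #|many_beaten s (nbelow x - k).+1 x| = #|@branch n [::]|.
Proof.
move=> sV km; rewrite -(cardsID [set W | k <= Nx s x W] (branch [::])); congr (_ + _).
  by apply: eq_card => W; rewrite !inE andbT.
apply: eq_card => W; rewrite !inE andbT [RHS]andbC; apply: andb_id2l => tW.
by have := beaten_Nx sV x tW; lia.
Qed.

Lemma count_ge0 s x (k : nat) : valid_strategy s -> nbelow x < k -> count_ge s x k = 0.
Proof.
move=> sV mk; apply: eq_card0 => W; rewrite !inE; apply/negP=> /andP[tW].
by have := beaten_Nx sV x tW; lia.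
Qed.

Lemma better_forP s s' x : valid_strategy s -> valid_strategy s' ->
  better_for x s s' <-> forall j : nat, 0 < j <= nbelow x ->
    #|many_beaten s j x| <= #|many_beaten s' j x|.
Proof.
move=> sV sV'; split=> [bet j jm|fewer k /andP[k0 kn]].
  (* Having at least [j] alternatives above [x] is the complement of [Nx] being at least
     [nbelow x - j + 1]. *)
  have km : nbelow x - j.-1 <= nbelow x by lia.
  have := count_geE sV km; have := count_geE sV' km.
  have -> : (nbelow x - (nbelow x - j.-1)).+1 = j by lia.
  have := bet (nbelow x - j.-1); have : nbelow x <= n.-1 by rewrite /nbelow; lia.
  by lia.
have [mk|km] := ltnP (nbelow x) k; first by rewrite !count_ge0.
have := count_geE sV km; have := count_geE sV' km.
by have := fewer (nbelow x - k).+1; lia.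
Qed.

(** * Insertion sort *)

Lemma isortP (h : history n) : is_history h -> ~~ total_hist h ->
  exists x y, [/\ insertion_sort h = Some (x, y), y \in Lset h x,
    forall z : 'I_n, x < z -> Lset h z = set0 & forall w, w \in Lset h x -> ~~ tc h w y].
Proof.
move=> hh ht; rewrite /insertion_sort; case: pickP => [x /andP[Lx /forallP xmax]|noX].
  case: pickP => [y /andP[yL /forallP ytop]|noY].
    exists x, y; split=> // [z xz|w wL]; first by apply/eqP; apply: (implyP (xmax z)).
    exact: (implyP (ytop w)).
  have /set0Pn[y0 y0L] := Lx.
  (* An element with the most alternatives weakly below it is highest: anything strictly above it
     would have more. *)
  case: (arg_maxnP (fun y => #|[set w | conn h y w]|) y0L) => y yL ymax.
  case/negP: (noY y); rewrite (yL : y \in Lset h x).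
  apply/forallP=> w; apply/implyP=> wL; apply/negP=> wy.
  have /= := ymax w wL; rewrite leqNgt => /negP[]; apply: proper_card.
  have wyC : conn h w y by rewrite conn_tc wy orbT.
  apply/properP; split.
    by apply/subsetP=> z; rewrite !inE; apply: connect_trans.
  exists w; rewrite inE; first exact: connect0.
  apply/negP=> /(history_antisym hh wyC) wE.
  by rewrite wE history_tc_irr in wy.
have /forallPn[a /forallPn[b]] := ht.
rewrite negb_imply negb_or => /and3P[nab tab tba].
have [x0 x0L] : exists x : 'I_n, Lset h x != set0.
  have uab : unranked h a b by rewrite /unranked nab tab.
  case: (ltngtP a b) => [ab|ba|/val_inj abE]; last by rewrite abE eqxx in nab.
    by exists a; apply/set0Pn; exists b; rewrite inE uab andbT.
  by exists b; apply/set0Pn; exists a; rewrite inE unranked_sym uab andbT.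
case: (@arg_maxnP _ x0 (fun x => Lset h x != set0) (@nat_of_ord n) x0L) => x xL xmax.
case/negP: (noX x); rewrite xL; apply/forallP=> z; apply/implyP=> xz.
by apply: contraTT xz => /xmax zx; rewrite /chair_pref -leqNgt.
Qed.

Lemma isort_valid : valid_strategy (@insertion_sort n).
Proof.
move=> h hh ht; have [x [y [-> + _ _]]] := isortP hh ht.
by rewrite inE => /andP[].
Qed.

(** If [b] and [c] were unranked with each other, the better of them would have a nonempty [Lset],
    against the choice of [x] as the worst such alternative. So they are ranked, and [b] is the
    higher. *)
Lemma isort_top_first x : top_first (@insertion_sort n) x.
Proof.
move=> h b rh ht sh xb c xc uxc cb.
have [x0 [y0 [sE yL Lmax ytop]]] := isortP (reach_history isort_valid rh) ht.
have [xE yE] : x0 = x /\ y0 = b.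
  move: yL; rewrite inE => /andP[x0y0 _].
  case: sh; rewrite sE => -[xE yE] //; move: x0y0.
  by rewrite /chair_pref xE yE ltnNge ltnW.
subst x0 y0; have cL : c \in Lset h x by rewrite inE uxc andbT.
have /orP[//|cbh] : conn h b c || conn h c b.
  apply: contraTT isT; rewrite negb_or -unrankedE => ubc.
  have [bc|cb'|bcE] := ltngtP b c.
  - have : c \in Lset h b by rewrite inE ubc andbT.
    by rewrite Lmax // inE.
  - have : b \in Lset h c by rewrite inE unranked_sym ubc andbT.
    by rewrite Lmax // inE.
  - by case/eqP: cb; apply/esym/val_inj.
by case/negP: (ytop c cL); rewrite tc_conn.
Qed.

(** * Being top-first everywhere determines the outcome *)

Lemma final_rec s W x (y : 'I_n) : valid_strategy s -> (forall x, top_first s x) ->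
    tournament W -> x < y ->
  conn (final s W) x y = [exists z : 'I_n, [&& x < z, (x, z) \in W & conn (final s W) z y]].
Proof.
move=> sV ts tW xy; have rF := final_reach sV tW.
have cx : closed_among s x by apply: top_first_closed => //; apply: ltnW.
apply/idP/existsP=> [xyF|[z /and3P[xz xzW zy]]].
  have nxy : x != y by rewrite neq_ltn xy.
  have [z xzF zy] := conn_first (cx _ _ _ rF (leqnn x) (ltnW xy) xyF) nxy.
  move: xzF; rewrite mem_among => /and3P[_ xz xzF].
  exists z; rewrite (conn_sub (@among_sub _ _ _) zy) andbT.
  rewrite (allP (final_consistent sV tW) _ xzF) andbT ltn_neqAle xz andbT.
  by apply: contraTneq xzF => /val_inj <-; apply: reach_irr rF.
(* If [y] were above [x], so would be [z]; then [z] would have beaten [x] directly, against [W]. *)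
have /orP[//|yx] := totalP x y (final_total sV tW).
have zxF := direct_loss sV (ts x) cx rF xz (connect_trans zy yx).
have := allP (final_consistent sV tW) _ zxF.
by rewrite (tournament_sym tW) ?xzW // neq_ltn xz orbT.
Qed.

Lemma top_first_final s s' W : valid_strategy s -> valid_strategy s' ->
    (forall x, top_first s x) -> (forall x, top_first s' x) -> tournament W ->
  conn (final s W) =2 conn (final s' W).
Proof.
move=> sV sV' ts ts' tW.
pose agree (x : 'I_n) := forall y : 'I_n, x < y ->
  conn (final s W) x y = conn (final s' W) x y.
have conn_gt s0 (a b : 'I_n) : valid_strategy s0 -> b < a ->
    conn (final s0 W) a b = ~~ conn (final s0 W) b a.
  move=> s0V ba; have := totalP a b (final_total s0V tW).
  have := @reach_antisym _ _ s0V _ a b (final_reach s0V tW).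
  case: (conn _ a b); case: (conn _ b a) => // /(_ isT isT) abE.
  by rewrite abE ltnn in ba.
have agree2 (k : nat) : (forall x : 'I_n, k <= x -> agree x) ->
    forall a b : 'I_n, k <= a -> k <= b -> conn (final s W) a b = conn (final s' W) a b.
  move=> agk a b ka kb; have [ab|ba|/val_inj->] := ltngtP a b.
  - exact: agk.
  - by rewrite (conn_gt s a b) // (conn_gt s' a b) // (agk b kb a ba).
  - by rewrite /conn !connect0.
suff ag x : agree x by move=> a b; apply: (agree2 0).
(* Induction from the worst alternative upwards: [final_rec] refers only to [W] and to the ranking
   of alternatives worse than [x]. *)
have [m] := ubnP (n - x); elim: m x => // m IHm x; rewrite ltnS => xm y xy.
rewrite !final_rec //; apply: eq_existsb => z.
have [xz|//] := ltnP x z; rewrite (agree2 x.+1) // => x' xx'.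
by apply: IHm; have := ltn_ord x'; lia.
Qed.

Lemma top_first_outcome s s' : valid_strategy s -> valid_strategy s' ->
    (forall x, top_first s x) -> (forall x, top_first s' x) ->
  outcome_equivalent s s'.
Proof.
move=> sV sV' ts ts' W tW x y; rewrite /outcome -/(final s W) -/(final s' W).
have [->|nxy] := eqVneq x y; last by rewrite !tc_conn // (top_first_final sV sV').
by rewrite !history_tc_irr //; apply: reach_history (final_reach _ tW).
Qed.

(** * Lexicographic strategies *)

Lemma Bset_valid s (k : nat) : k <= n -> Bset k s -> valid_strategy s.
Proof. by elim: k => // k IHk kn /(_ kn)[/(IHk (ltnW kn))]. Qed.

(** By induction, every member of [Bset k] is subject to the bound of [many_beaten_ge] at the next
    alternative. Insertion sort attains it, so being best there means attaining it, that is, being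
    calibrated and hence top-first. *)
Lemma BsetP s (k : nat) : valid_strategy s -> k <= n ->
  Bset k s <-> forall x : 'I_n, x < k -> top_first s x.
Proof.
move=> + kn; elim: k kn s => [|k IHk] kn s sV; first by split.
set x := Ordinal kn; have is_isort_best : Bset k (@insertion_sort n).
  by apply/(IHk (ltnW kn) _ isort_valid) => y _; apply: isort_top_first.
have closed s' : valid_strategy s' ->
    (forall y : 'I_n, y < k -> top_first s' y) -> closed_among s' x.
  by move=> sV' ts'; apply: top_first_closed => //; apply: ltnW.
split=> [/(_ kn) [Bs best] y|ts kn'].
  have ts := (IHk (ltnW kn) s sV).1 Bs.
  rewrite ltnS leq_eqVlt => /orP[/eqP yE|]; last exact: ts.
  have -> : y = x by apply: val_inj.
  apply: calibrated_top_first => //; apply/calibratedP => //; first exact: closed.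
  move=> j jm; have /(better_forP x sV isort_valid)/(_ j jm) le_isort := best _ is_isort_best.
  apply: leq_trans (_ : 2 ^ j * #|many_beaten (@insertion_sort n) j x| <= _).
    by rewrite leq_mul2l le_isort orbT.
  move: j jm {le_isort}; apply/calibratedP; first exact: isort_valid.
    by apply: closed isort_valid _ => z _; apply: isort_top_first.
  apply: top_first_calibrated; [exact: isort_valid | exact: isort_top_first |].
  by apply: closed isort_valid _ => z _; apply: isort_top_first.
rewrite (bool_irrelevance kn' kn) -/x.
have tsk (y : 'I_n) : y < k -> top_first s y by move=> yk; apply/ts/ltnW.
split; first exact/(IHk (ltnW kn) s sV).
move=> s' Bs'; have s'V := Bset_valid (ltnW kn) Bs'; apply/better_forP => // j jm.
have cal : calibrated s x.
  by apply: top_first_calibrated => //; [apply: ts | apply: closed].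
have := (calibratedP sV (closed _ sV tsk)).1 cal j jm.
have := many_beaten_ge s'V (closed _ s'V ((IHk (ltnW kn) _ s'V).1 Bs')) jm.
move=> /[swap] /leq_trans/[apply]; by rewrite leq_pmul2l ?expn_gt0.
Qed.

Lemma outcome_equivalent_better s s1 s2 x :
  outcome_equivalent s1 s2 -> better_for x s1 s -> better_for x s2 s.
Proof.
move=> eq12; suff cE k : count_ge s1 x k = count_ge s2 x k.
  by move=> bet k /bet; rewrite cE.
apply: eq_card => W; rewrite !inE; apply: andb_id2l => tW.
congr (k <= _); apply: eq_card => y; rewrite !inE; apply: andb_id2l => _.
exact: eq12.
Qed.

(** The comparisons see outcomes only. This carries membership over from insertion sort without
    first showing that the other strategy is top-first. *)
Lemma outcome_equivalent_Bset s s' (k : nat) : valid_strategy s' ->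
  outcome_equivalent s s' -> k <= n -> Bset k s -> Bset k s'.
Proof.
move=> sV' eqss; elim: k => // k IHk kn Bs kn'.
have [Bks best] := Bs kn'; split; first exact: IHk (ltnW kn) Bks.
by move=> s0 /best; apply: outcome_equivalent_better.
Qed.

End Counting.

Unset Implicit Arguments.

Theorem theorem4 (n : nat) (s : strategy n) :
  valid_strategy s ->
  (outcome_equivalent s (@insertion_sort n) <-> lexicographic s).
Proof.
have iV := @isort_valid n; have iT := @isort_top_first n.
move=> sV; split=> [eqs k kn|lex]; last first.
  apply: top_first_outcome => // x.
  exact: ((BsetP sV (leqnn n)).1 (lex n (leqnn n)) x (ltn_ord x)).
apply: (outcome_equivalent_Bset sV _ kn) ((BsetP iV kn).2 (fun x _ => iT x)).
by move=> W tW x y; rewrite eqs.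
Qed.
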